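(* The following assertions are true: (a) For every positive integer $m$, Stanley's conjecture is true for trees with at most $\Phi(m)-1$ vertices; that is, any two trees with at most $\Phi(m)-1$ vertices having the same $U$-polynomial are isomorphic. (b) Stanley's conjecture is true if and only if $\lim_{m\to\infty}\Phi(m)=\infty$. (c) If for every integer $m\ge 2$ $$\Phi(m)=\begin{cases}6\cdot 2^{m/2}-2,&\text{if } m \text{ is even},\\ 6\cdot 3\cdot 2^{\lfloor m/2\rfloor-1}-2,&\text{if } m\text{ is odd},\end{cases}$$ then Stanley's conjecture is true.
   Context: All trees are finite and unrooted. Let $x_1,x_2,\dots$ be commuting indeterminates. For a tree $T=(V,E)$ with $n$ vertices and $A\subseteq E$, let $\lambda(A)$ be the partition of $n$ whose parts are the numbers of vertices of the connected components of the spanning subgraph $(V,A)$, and for a partition $\lambda=(\lambda_1,\dots,\lambda_s)$ put $\mathbf{x}_\lambda=x_{\lambda_1}\cdots x_{\lambda_s}$. The $U$-polynomial is $U(T)=\sum_{A\subseteq E}\mathbf{x}_{\lambda(A)}$, and for an integer $m\ge0$ the restricted polynomial $U_m(T)$ consists of exactly the terms of $U(T)$ of total degree at most $m+1$, i.e. $U_m(T)=\sum_{A\subseteq E,\ |A|\ge n-m-1}\mathbf{x}_{\lambda(A)}$. Define $$\Phi(m):=\min\{l:\ \text{there exist non-isomorphic trees } H,G \text{ with } l \text{ vertices each such that } U_m(H)=U_m(G)\}.$$ This is known to be finite for every $m$. Stanley's conjecture is the assertion that any two trees with the same $U$-polynomial are isomorphic (for trees, having the same $U$-polynomial is equivalent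 to having the same chromatic symmetric function). *)

(* Defs.v *)
From mathcomp Require Import all_boot all_order all_algebra.
From mathcomp Require Import boolp constructive_ereal.
(* The notations of monalg clash with those of MathComp-Analysis. *)
From mathcomp Require Import -(notations) monalg.

Set Implicit Arguments.
Unset Strict Implicit.
Unset Printing Implicit Defensive.

Local Open Scope ring_scope.

(* In [tree_acyclic] the bound on the size is needed because [ucycle] also holds
   of the empty sequence and of an edge traversed back and forth. *)
Record tree := Tree {
  vertex :> finType;
  adj : rel vertex;
  adj_sym : symmetric adj;
  adj_irr : irreflexive adj;
  tree_nonempty : (0 < #|vertex|)%N;
  tree_connected : forall x y, connect adj x y;
  tree_acyclic : forall c : seq vertex, ucycle adj c -> (size c <= 2)%N
}.

Definition tree_iso (H G : tree) : Prop :=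
  exists f : H -> G, bijective f /\ forall x y, adj (f x) (f y) = adj x y.

Definition edges (T : tree) : {set {set T}} :=
  [set [set p.1; p.2] | p in [pred p : T * T | adj p.1 p.2]].

(* Used only for [A \subset edges T], so that A contains no singleton and the
   relation is irreflexive. *)
Definition subadj (T : tree) (A : {set {set T}}) : rel T :=
  [rel x y | [set x; y] \in A].

Definition components (T : tree) (A : {set {set T}}) : {set {set T}} :=
  equivalence_partition (connect (subadj A)) [set: T].

(* A partition is represented by the weakly decreasing list of its parts. *)
Definition lambda (T : tree) (A : {set {set T}}) : seq nat :=
  sort geq [seq #|C| | C : {set T} <- enum (components A)].

(* Integer polynomials in the countably many indeterminates [x_ i]; [x_ 0] never
   occurs, since the parts of a partition are positive. *)
Definition Upoly := malg (cmonom nat) int.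

Definition x_ (i : nat) : Upoly := mkmalgU (ucm i) 1.

Definition x_part (l : seq nat) : Upoly := \prod_(i <- l) x_ i.

Definition U (T : tree) : Upoly :=
  \sum_(A : {set {set T}} | A \subset edges T) x_part (lambda A).

(* The truncated subtraction is harmless: for n < m + 1 the bound is vacuous. *)
Definition U_restricted (m : nat) (T : tree) : Upoly :=
  \sum_(A : {set {set T}} | (A \subset edges T) && (#|T| - m - 1 <= #|A|)%N)
     x_part (lambda A).

Definition collision (m l : nat) : Prop :=
  exists H G : tree, [/\ #|H| = l, #|G| = l, ~ tree_iso H G &
    U_restricted m H = U_restricted m G].

(* The minimum of the set of l such that [collision m l], with the convention
   that the minimum of the empty set is +oo.  The set is in fact never empty;
   the convention makes the definition independent of that theorem.  The field
   rat serves only to provide the order and topology of the extended line. *)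
Definition Phi (m : nat) : \bar rat :=
  match pselect (exists l, `[< collision m l >]) with
  | left ex => ((ex_minn ex)%:R)%:E
  | right _ => +oo%E
  end.

Definition stanley_conjecture : Prop :=
  forall H G : tree, U H = U G -> tree_iso H G.

(* Main.v *)
Require Import Defs.
From mathcomp Require Import all_boot all_order all_algebra.
From mathcomp Require Import boolp classical_sets constructive_ereal.
From mathcomp Require Import topology ereal normedtype sequences.
From mathcomp Require Import -(notations) monalg.
From mathcomp Require Import zify.

Set Implicit Arguments.
Unset Strict Implicit.
Unset Printing Implicit Defensive.

Import Order.TTheory GRing.Theory Num.Theory.

Local Open Scope ring_scope.

(** Everything rests on one fact about a tree T with n vertices: a set A of
    edges has exactly n - |A| components ([card_components]), because each
    edge of a tree joins two components of the edges chosen before it.  So the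
    total degree of the monomial of A is n - |A|, with two consequences.

    First, the bound |A| >= n - m - 1 says that the monomial has degree at most
    m + 1.  Hence the coefficients of U_m(T) are those of U(T) in degrees at
    most m + 1 and vanish in higher degrees ([mcoeff_U_restricted]), and U(T)
    determines U_m(T) for every m.  Second, n is the degree of U(T), attained
    at A = set0, so U(T) determines n ([U_card]).

    Therefore two non-isomorphic trees with n vertices and the same U-polynomial
    form a collision for every m, and then Phi m <= n for every m
    ([U_inj_below_Phi]).  This gives (a); it also shows that an unbounded Phi
    forces the conjecture, which is one direction of (b), and (c) follows since
    the given values are unbounded.

    Conversely, U_m(T) = U(T) as soon as n <= m + 1.  Under the conjecture the
    trees of a collision for m thus have more than m + 1 vertices, so that
    m <= Phi m ([stanley_Phi_ge]) and Phi tends to infinity. *)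

(** * Components of a set of edges *)

Lemma set2_inj (V : finType) (u v x y : V) :
  [set u; v] = [set x; y] -> u = x /\ v = y \/ u = y /\ v = x.
Proof.
move=> E; have: u \in [set x; y] by rewrite -E set21.
have: v \in [set x; y] by rewrite -E set22.
have: x \in [set u; v] by rewrite E set21.
have: y \in [set u; v] by rewrite E set22.
by rewrite !inE => /pred2P[]-> /pred2P[]-> /pred2P[]? /pred2P[]?; auto.
Qed.

(** Connectedness in an enlarged relation is controlled by exhibiting an
    invariant of its single steps. *)
Lemma connect_invariant (V : finType) (e : rel V) (S : eqType) (f : V -> S) :
  (forall u v, e u v -> f u = f v) -> forall u v, connect e u v -> f u = f v.
Proof.
move=> fe u _ /connectP[p ep ->].
by elim: p u ep => //= v p IHp u /andP[/fe-> /IHp].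
Qed.

(** An edge between two different components merges these two and leaves the
    others as they are. *)
Lemma card_classes_add_edge (V : finType) (e e' : rel V) (x y : V) :
    symmetric e ->
    (forall u v, e' u v = e u v || ([set u; v] == [set x; y])) ->
    ~~ connect e x y ->
  #|equivalence_partition (connect e) [set: V]| =
  #|equivalence_partition (connect e') [set: V]|.+1.
Proof.
move=> sym_e e'E not_xy.
have sym_e' : symmetric e'.
  by move=> u v; rewrite !e'E sym_e finset.setUC.
have symR := sym_connect_sym sym_e; have symR' := sym_connect_sym sym_e'.
pose R := connect e; pose R' := connect e'.
have trR : transitive R by exact: connect_trans.
have trR' : transitive R' by exact: connect_trans.
have RR' u v : R u v -> R' u v.
  apply: connect_sub => {}u {}v euv; apply: connect1.
  by rewrite e'E euv.
have R'xy : R' x y by apply: connect1; rewrite e'E !eqxx orbT.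
pose S := [set w | R' x w].
(* The class of x for e' is the union of the classes of x and y for e. *)
have SE w : R' x w = R x w || R y w.
  apply/idP/idP; last first.
    by case/orP=> /RR' //; apply: trR'.
  move=> xw; suff <- : R x x || R y x = R x w || R y w by rewrite /R connect0.
  apply: (connect_invariant (f := fun w => R x w || R y w)) xw => u v.
  rewrite e'E => /orP[euv|/eqP/set2_inj[][-> ->]].
  - by rewrite /R /= -!(same_connect_r symR (connect1 euv)).
  - by rewrite /R /= !connect0 ?orbT.
  - by rewrite /R /= !connect0 ?orbT.
(* Away from that class, e and e' have the same classes. *)
have outE z : ~~ R' x z -> R' z =1 R z.
  move=> nxz w; apply/idP/idP; last exact: RR'.
  have [nzx nzy] : ~~ R z x /\ ~~ R z y.
    by move: nxz; rewrite SE negb_or /R symR (symR y) => /andP[].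
  move=> zw; suff <- : R z z = R z w by rewrite /R connect0.
  apply: (connect_invariant (f := R z)) zw => u v.
  rewrite e'E => /orP[euv|/eqP/set2_inj[][-> ->]].
  - by rewrite /R /= (same_connect_r symR (connect1 euv)).
  - by rewrite (negbTE nzx) (negbTE nzy).
  - by rewrite (negbTE nzx) (negbTE nzy).
(* The classes missing the class of x for e' are common to both partitions. *)
pose cls (r : rel V) z := [set w in [set: V] | r z w].
pose out := [set cls R z | z in ~: S].
have clsE (r : rel V) z w : (w \in cls r z) = r z w by rewrite !inE.
have eqcls (r : rel V) : symmetric r -> transitive r -> forall z w,
    r z w -> cls r z = cls r w.
  move=> symr trr z w rzw; apply/setP=> v; rewrite !clsE.
  apply/idP/idP; last exact: trr.
  by apply: trr; rewrite symr.
have eqR := eqcls R symR trR.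
have eqR' := eqcls R' symR' trR'.
have PE : equivalence_partition R [set: V] = cls R x |: (cls R y |: out).
  apply/setP=> C; apply/imsetP/idP => [[z _ ->]|].
  - rewrite -/(cls R z); have [xz|nxz] := boolP (R' x z).
      by move: xz; rewrite SE => /orP[] /eqR <-; rewrite !inE eqxx ?orbT.
    rewrite !inE; apply/orP; right; apply/orP; right.
    by apply: imset_f; rewrite !inE.
  - rewrite !inE => /or3P[/eqP->|/eqP->|/imsetP[z _ ->]];
      [exists x|exists y|exists z] => //.
have P'E : equivalence_partition R' [set: V] = cls R' x |: out.
  apply/setP=> C; apply/imsetP/idP => [[z _ ->]|].
  - rewrite -/(cls R' z); have [/eqR' <-|nxz] := boolP (R' x z).
      by rewrite !inE eqxx.
    rewrite !inE; apply/orP; right; apply/imsetP; exists z; rewrite ?inE //.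
    by apply/setP=> w; rewrite !clsE outE.
  - rewrite !inE => /orP[/eqP->|/imsetP[z]]; first by exists x.
    rewrite !inE => nxz ->; exists z => //.
    by apply/setP=> w; rewrite -/(cls R' z) !clsE outE.
have out_notin (r : rel V) z : (forall w, r w w) -> R' x z -> cls r z \notin out.
  move=> r0 xz; apply/imsetP=> -[w]; rewrite !inE => nxw /setP/(_ z).
  rewrite !clsE r0 => /esym/RR' wz; case/negP: nxw.
  by apply: trR' xz _; rewrite /R' symR'.
rewrite -/R -/R' PE P'E !cardsU1 !inE negb_or.
rewrite !out_notin ?andbT //; try by move=> *; exact: connect0.
suff -> : cls R x != cls R y by [].
by apply: contraNneq not_xy => /setP/(_ y); rewrite !clsE [R y y]connect0.
Qed.

Lemma subadj_sym (T : tree) (A : {set {set T}}) : symmetric (subadj A).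
Proof. by move=> u v; rewrite /subadj /= finset.setUC. Qed.

Lemma edgesP (T : tree) (B : {set T}) :
  reflect (exists x y, adj x y /\ B = [set x; y]) (B \in edges T).
Proof.
apply: (iffP imsetP) => [[[x y]]|[x [y [axy ->]]]].
  by rewrite inE /= => axy ->; exists x, y.
by exists (x, y).
Qed.

Lemma edge_adj (T : tree) (x y : T) : [set x; y] \in edges T -> adj x y.
Proof.
case/edgesP=> u [v [auv E]].
by case: (set2_inj E) => -[-> ->]; rewrite // adj_sym.
Qed.

(** A simple path from x to y in A, closed up by the edge [set x; y], would be a
    cycle of the tree. *)
Lemma edge_separates (T : tree) (A : {set {set T}}) (x y : T) :
    A \subset edges T -> adj x y -> [set x; y] \notin A ->
  ~~ connect (subadj A) x y.
Proof.
move=> /fintype.subsetP sA axy nA; apply/negP=> /connectP[p Ap ylast].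
case/shortenP: Ap ylast => q Aq uq _ ylast.
have aq : path (@adj T) x q.
  by apply: sub_path Aq => u v /sA/edge_adj.
have uc : ucycle (@adj T) (x :: q).
  by rewrite /ucycle /= rcons_path aq -ylast adj_sym axy /=.
(* The path has at most one edge, which can only be [set x; y] itself. *)
have := tree_acyclic uc; case: q Aq ylast {aq uc uq} => [|z [|//]] /=.
  by move=> _ eyx; rewrite eyx adj_irr in axy.
rewrite andbT => xzA eyz; by case/negP: nA; rewrite eyz.
Qed.

(** By induction on the number of edges of A: without edges every vertex is a
    component, and each edge lowers the number of components by one. *)
Lemma card_components (T : tree) (A : {set {set T}}) :
  A \subset edges T -> (#|components A| + #|A|)%N = #|T|.
Proof.
move: {2}#|A| (erefl #|A|) => k; elim: k A => [|k IHk] A cardA sA.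
  move/eqP: (cardA); rewrite cards_eq0 => /eqP A0.
  rewrite A0 cards0 addn0 /components /equivalence_partition.
  rewrite card_imset ?cardsT //.
  move=> u v /setP/(_ v); rewrite !inE connect0 => /connectP[[|w p] //=].
  by rewrite {1}/subadj /= finset.in_set0.
have /card_gt0P[B BA] : (0 < #|A|)%N by rewrite cardA.
have /edgesP[x [y [axy EB]]] := fintype.subsetP sA _ BA.
have cardD : #|A :\ B| = k by move: cardA; rewrite (cardsD1 B) BA => -[].
have sD : A :\ B \subset edges T by rewrite (fintype.subset_trans _ sA) ?finset.subsetDl.
rewrite -(IHk _ cardD sD) cardA cardD /components.
rewrite (@card_classes_add_edge _ (subadj (A :\ B)) (subadj A) x y) ?addSnnS //.
- exact: subadj_sym.
- move=> u v; rewrite /subadj /= in_setD1 -EB orbC.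
  by case: eqP => // ->.
- apply: edge_separates => //.
  by rewrite -EB !inE eqxx.
Qed.
(** * Coefficients of the U-polynomial *)

Definition monom_of_parts (l : seq nat) : cmonom nat :=
  \big[mul/one]_(i <- l) ucm i.

Lemma x_partE l : x_part l = mkmalgU (monom_of_parts l) 1.
Proof.
rewrite /x_part /monom_of_parts; elim: l => [|i l IHl]; first by rewrite !big_nil.
rewrite !big_cons IHl; apply: etrans (malgM_def _ _) _.
rewrite fgmulUU (mulr1 (1 : int)); reflexivity.
Qed.

Lemma mdeg_monom_of_parts l : mdeg (monom_of_parts l) = size l.
Proof.
rewrite mdeg_prod (eq_bigr (fun=> 1%N)) => [|i _]; last exact: mdegU.
by rewrite sum1_size.
Qed.

Lemma mdeg_lambda (T : tree) (A : {set {set T}}) :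
  mdeg (monom_of_parts (lambda A)) = #|components A|.
Proof. by rewrite mdeg_monom_of_parts size_sort size_map -cardE. Qed.

Lemma mcoeff_U (T : tree) k : mcoeff k (U T) =
  \sum_(A : {set {set T}} | A \subset edges T)
     (monom_of_parts (lambda A) == k)%:R.
Proof.
rewrite raddf_sum /=; apply: eq_bigr => A _.
by rewrite x_partE mcoeffU1.
Qed.

(** The number of edges of A can be read off the degree of its monomial, so
    restricting the sum amounts to truncating the polynomial by degree. *)
Lemma mcoeff_U_restricted m (T : tree) k :
  mcoeff k (U_restricted m T) = mcoeff k (U T) *+ (mdeg k <= m + 1)%N.
Proof.
rewrite raddf_sum mcoeff_U /= big_mkcondr /= -sumrMnl; apply: eq_bigr => A sA.
rewrite x_partE mcoeffU1 -subnDA leq_subLR -(card_components sA) leq_add2r.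
rewrite -mdeg_lambda.
case: eqP => [->|_]; last by case: ifP; rewrite mul0rn.
by case: ifP.
Qed.

Lemma U_restricted_eq m (H G : tree) :
  U H = U G -> U_restricted m H = U_restricted m G.
Proof. by move=> E; apply/malgP=> k; rewrite !mcoeff_U_restricted E. Qed.

Lemma U_restricted_full m (T : tree) :
  (#|T| <= m + 1)%N -> U_restricted m T = U T.
Proof.
move=> leT; apply: eq_bigl => A.
by rewrite -subnDA (eqP (leT : _ - _ == 0)%N) andbT.
Qed.

(** The monomial of the empty set of edges of H, of degree #|H|, occurs in U G,
    all of whose monomials have degree at most #|G|. *)
Lemma U_card_le (H G : tree) : U H = U G -> (#|H| <= #|G|)%N.
Proof.
move=> E; pose k := monom_of_parts (lambda (finset.set0 : {set {set H}})).
have degk : mdeg k = #|H|.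
  by rewrite mdeg_lambda -(card_components (finset.sub0set _)) cards0 addn0.
(* The coefficients are counts, hence no cancellation. *)
have : 0 < mcoeff k (U H).
  rewrite mcoeff_U (bigD1 finset.set0) ?finset.sub0set //= eqxx.
  by rewrite ltr_wpDr // sumr_ge0.
rewrite E mcoeff_U -degk.
have [[A]|/forallPNP noA] := pselect (exists2 A : {set {set G}},
    A \subset edges G & monom_of_parts (lambda A) = k).
  by move=> sA <- _; rewrite mdeg_lambda -(card_components sA) leq_addr.
rewrite big1 ?ltxx // => A sA.
by case: eqP => // /noA; case.
Qed.

Lemma U_card (H G : tree) : U H = U G -> #|H| = #|G|.
Proof. by move=> E; apply/eqP; rewrite eqn_leq !U_card_le. Qed.

(** * Bounds on Phi *)

Lemma Phi_le m l : collision m l -> (Phi m <= l%:R%:E)%E.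
Proof.
move=> ml; rewrite /Phi; case: pselect => [ex|[]]; last by exists l; apply/asboolP.
by case: ex_minnP => n _ minn; rewrite lee_fin ler_nat minn //; apply/asboolP.
Qed.

Lemma Phi_ge m n :
  (forall l, collision m l -> (n <= l)%N) -> (n%:R%:E <= Phi m)%E.
Proof.
move=> ge_n; rewrite /Phi; case: pselect => [ex|_]; last exact: leey.
by case: ex_minnP => l /asboolP /ge_n; rewrite lee_fin ler_nat.
Qed.

(** A pair of non-isomorphic trees with the same U-polynomial is a collision for
    every m, since U determines U_m. *)
Lemma U_inj_below_Phi m (H G : tree) :
  (#|H|%:R%:E < Phi m)%E -> U H = U G -> tree_iso H G.
Proof.
move=> ltPhi E; apply: contrapT => nHG.
have /Phi_le : collision m #|H|.
  by exists H, G; split; rewrite ?(U_card E) //; apply: U_restricted_eq.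
by rewrite leNgt ltPhi.
Qed.

(** On trees with at most m + 1 vertices U_m is the whole U-polynomial, so there
    the conjecture excludes collisions. *)
Lemma stanley_Phi_ge m : stanley_conjecture -> (m%:R%:E <= Phi m)%E.
Proof.
move=> stanley; apply: Phi_ge => l [H [G [cardH cardG nHG E]]].
rewrite leqNgt; apply/negP => ltlm; apply: nHG; apply: stanley.
have leq_m : (l <= m + 1)%N by rewrite addn1 ltnW // ltnW.
by rewrite -(U_restricted_full (m := m)) ?cardH // E U_restricted_full ?cardG.
Qed.

(** * The theorem *)

Local Open Scope classical_set_scope.

Theorem proposition16 :
  [/\ (forall m : nat, (0 < m)%N ->
         forall H G : tree,
           (#|H|%:R%:E <= Phi m - 1)%E -> (#|G|%:R%:E <= Phi m - 1)%E ->
           U H = U G -> tree_iso H G),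
      (stanley_conjecture <-> (Phi m @[m --> \oo] --> +oo%E))
    & ((forall m : nat, (2 <= m)%N ->
          Phi m = (if odd m then 6 * 3 * 2 ^+ (m./2 - 1)%N - 2
                   else 6 * 2 ^+ m./2 - 2)%:E) ->
       stanley_conjecture)].
Proof.
split=> [m _ H G leH _ | | PhiE H G].
- apply: (@U_inj_below_Phi m); move: leH; case: (Phi m) => [r||//].
    rewrite -EFinB lee_fin lte_fin => /le_lt_trans; apply.
    by rewrite ltrBlDr ltrDl.
  by move=> _; exact: ltry.
- split=> [stanley|/cvgeyPgt cvgPhi H G].
    apply/cvgeyPge => a; near=> m.
    apply: le_trans (stanley_Phi_ge m stanley); rewrite lee_fin.
    have ltaN := archi_boundP (normr_ge0 a).
    apply: le_trans (ler_norm a) _.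
    by apply: le_trans (ltW ltaN) _; rewrite ler_nat; near: m; exact: nbhs_infty_ge.
  have [m] := filter_ex (cvgPhi #|H|%:R).
  exact: U_inj_below_Phi.
(* Any even m whose value 6 * 2 ^ (m / 2) - 2 exceeds #|H| will do. *)
- pose k := #|H|.+1; apply: (@U_inj_below_Phi k.*2).
  rewrite PhiE ?(leq_double 1) // odd_double doubleK lte_fin ltrBrDr.
  rewrite -natrD -natrX -natrM ltr_nat.
  have : (k < 2 ^ k)%N by exact: ltn_expl.
  rewrite /k; lia.
Unshelve. all: by end_near.
Qed.
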